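(* Let $h>0$, let $B\subset\mathbb Z^8_h$ be bounded and let $f:\partial B\to\mathbb O$. Then $$C^h_{\partial B}f(y)=\tfrac12\big(f(y)+S^h_{\partial B}f(y)\big)\ \text{ for all } y\in\partial^+B,\qquad C^h_{\partial B}f(y)=\tfrac12\big(-f(y)+S^h_{\partial B}f(y)\big)\ \text{ for all } y\in\partial^-B.$$
   Context: $\mathbb O$ is the real octonion algebra with basis $\mathbf e_0=1,\mathbf e_1,\dots,\mathbf e_7$, where $\mathbf e_i\mathbf e_j=-\delta_{ij}+\sum_k\varepsilon_{ijk}\mathbf e_k$ for $1\le i,j\le 7$, $\varepsilon_{ijk}$ totally antisymmetric with $\varepsilon_{ijk}=1$ for $ijk\in\{123,145,176,246,257,347,365\}$; $\overline{\mathbf e}_0=\mathbf e_0$, $\overline{\mathbf e}_l=-\mathbf e_l$ ($l\ge1$). For $h>0$, $\mathbb Z^8_h=(h\mathbb Z)^8$, $e_0,\dots,e_7$ are the standard unit vectors of $\mathbb R^8$, $\chi_A$ is the indicator of $A$. $\partial_l^{+,h}f(x)=(f(x+he_l)-f(x))/h$, $\partial_l^{-,h}f(x)=(f(x)-f(x-he_l))/h$. $N(x)=\{x,x\pm he_0,\dots,x\pm he_7\}$; $\partial B=\{x:\ N(x)\cap B\neq\emptyset,\ N(x)\cap(\mathbb Z^8_h\setminus B)\neq\emptyset\}$, $\partial^+B=\partial B\cap B$, $\partial^-B=\partial B\setminus B$. For $x\in\partial B$: $\Sigma(x)=\sum_l[(\partial_l^{+,h}\chi_B(x))^2+(\partial_l^{-,h}\chi_B(x))^2]$,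 $s(x)=\frac{h^8}{2}\sqrt{\Sigma(x)}$, $n_l^\pm(x)=-2\partial_l^{\pm,h}\chi_B(x)/\sqrt{\Sigma(x)}$, $\int_{\partial B}g\,dS=\sum_{x\in\partial B}g(x)s(x)$. Fundamental solution: $E^1(x)=\frac{1}{(2\pi)^8}\int_{[-\pi,\pi]^8}\frac{\sum_l\overline{\mathbf e}_l\sin u_l}{\sum_l\sin^2u_l}\sin(\sum_lu_lx_l)\,du$ ($x\in\mathbb Z^8$), $E^h(x)=h^{-7}E^1(x/h)$. Star product: $K^h(x,y)*g(x)=-\frac12\sum_{l=0}^7\big(E^h(he_l-x+y)n_l^-(x)+E^h(-he_l-x+y)n_l^+(x)\big)(\mathbf e_lg(x))$. Operators on $g:\partial B\to\mathbb O$: $C^h_{\partial B}g(y)=\int_{\partial B}K^h(x,y)*g(x)\,dS(x)$ ($y\in\mathbb Z^8_h$), and $S^h_{\partial B}g(y)=2\int_{\partial B}K^h(x,y)*\big(g(x)-g(y)\big)\,dS(x)+g(y)$ ($y\in\partial B$), where in the latter the star product is applied to the function $x\mapsto g(x)-g(y)$. *)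

(* Defs.v *)
From HB Require Import structures.
From mathcomp Require Import all_boot all_order all_algebra.
From mathcomp Require Import all_classical all_reals all_analysis.
Set Implicit Arguments. Unset Strict Implicit. Unset Printing Implicit Defensive.
Import Order.TTheory GRing.Theory Num.Theory.
Local Open Scope classical_set_scope.
Local Open Scope ring_scope.

Section Octonions.
Variable R : realType.

Definition oct := 'rV[R]_8.

Definition oe (l : 'I_8) : oct := delta_mx 0 l.

(** the totally antisymmetric epsilon with eps_ijk = 1 for
    ijk in {123,145,176,246,257,347,365} *)
Definition fano_triples : seq (nat * nat * nat) :=
  [:: (1,2,3); (1,4,5); (1,7,6); (2,4,6); (2,5,7); (3,4,7); (3,6,5)]%N.

Definition cyc (t : nat * nat * nat) : seq (nat * nat * nat) :=
  let: (a, b, c) := t in [:: (a, b, c); (b, c, a); (c, a, b)].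

Definition eps (i j k : nat) : R :=
  if (i, j, k) \in flatten (map cyc fano_triples) then 1
  else if (j, i, k) \in flatten (map cyc fano_triples) then -1
  else 0.

(** structure constants: e_i e_j = \sum_k oc i j k e_k *)
Definition oc (i j k : 'I_8) : R :=
  if i == 0 :> nat then (j == k)%:R
  else if j == 0 :> nat then (i == k)%:R
  else if k == 0 :> nat then - (i == j)%:R
  else eps i j k.

Definition omul (a b : oct) : oct :=
  \row_k \sum_(i < 8) \sum_(j < 8) a 0 i * b 0 j * oc i j k.

Definition oebar (l : 'I_8) : oct := if l == 0 :> nat then oe l else - oe l.

(** Lattice Z^8_h: a point of Z^8_h is h*k with k : 'rV[int]_8 ; we work with
    the integer coordinate vector k. Standard unit vector: *)
Definition pt := 'rV[int]_8.
Definition ue (l : 'I_8) : pt := delta_mx 0 l.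

Fixpoint iterint (n : nat) (g : seq R -> R) (acc : seq R) : R :=
  match n with
  | 0%N => g acc
  | n'.+1 => Rintegral (@lebesgue_measure R) `[- pi, pi]%classic
               (fun t : R => iterint n' g (rcons acc t))
  end.

Definition dotu (u : seq R) (x : pt) : R :=
  \sum_(l < 8) nth 0 u l * ((x 0 l)%:~R).

Definition E1 (x : pt) : oct :=
  \sum_(l < 8) ((2 * pi) ^- 8 *
     iterint 8 (fun u => sin (nth 0 u l) * sin (dotu u x) /
                         \sum_(m < 8) (sin (nth 0 u m)) ^+ 2) [::]) *: oebar l.

(** E^h(h m) = h^-7 E^1(m) *)
Definition Eh (h : R) (m : pt) : oct := h ^- 7 *: E1 m.

Definition chi (B : set pt) (x : pt) : R := if pselect (B x) then 1 else 0.

Definition dplus (h : R) (B : set pt) (l : 'I_8) (x : pt) : R :=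
  (chi B (x + ue l) - chi B x) / h.
Definition dminus (h : R) (B : set pt) (l : 'I_8) (x : pt) : R :=
  (chi B x - chi B (x - ue l)) / h.

Definition nbhd (x : pt) : set pt :=
  [set z | z = x \/ exists l : 'I_8, z = x + ue l \/ z = x - ue l].

Definition bdry (B : set pt) : set pt :=
  [set x | (exists2 z, nbhd x z & B z) /\ (exists2 z, nbhd x z & ~ B z)].
Definition bdry_plus (B : set pt) : set pt := bdry B `&` B.
Definition bdry_minus (B : set pt) : set pt := bdry B `\` B.

Definition Sig (h : R) (B : set pt) (x : pt) : R :=
  \sum_(l < 8) ((dplus h B l x) ^+ 2 + (dminus h B l x) ^+ 2).
Definition sarea (h : R) (B : set pt) (x : pt) : R :=
  h ^+ 8 / 2 * Num.sqrt (Sig h B x).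
Definition nplus (h : R) (B : set pt) (l : 'I_8) (x : pt) : R :=
  - 2 * dplus h B l x / Num.sqrt (Sig h B x).
Definition nminus (h : R) (B : set pt) (l : 'I_8) (x : pt) : R :=
  - 2 * dminus h B l x / Num.sqrt (Sig h B x).

Definition bint (h : R) (B : set pt) (G : pt -> oct) : oct :=
  (\sum_(x \in bdry B) sarea h B x *: G x)%R.

Definition kstar (h : R) (B : set pt) (x y : pt) (g : pt -> oct) : oct :=
  - (2^-1) *: \sum_(l < 8)
     omul (nminus h B l x *: Eh h (ue l - x + y) + nplus h B l x *: Eh h (- ue l - x + y))
          (omul (oe l) (g x)).

Definition Cop (h : R) (B : set pt) (f : pt -> oct) (y : pt) : oct :=
  bint h B (fun x => kstar h B x y f).

Definition Sop (h : R) (B : set pt) (f : pt -> oct) (y : pt) : oct :=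
  2 *: bint h B (fun x => kstar h B x y (fun z => f z - f y)) + f y.

End Octonions.

(* Main.v *)
(**
The kernel operators differ only through the constant function [f y], so the
statement reduces to the discrete Cauchy formula for a constant [c]: the
boundary integral of [K(., y) * c] equals [chi_B(y) c]. Summation by parts turns
this integral into a sum over [B] of [1/2 sum_l (E(y-x+e_l) - E(y-x-e_l)) (e_l c)],
so it remains to see that [E] is a fundamental solution acting on constants. On
the Fourier side the central difference turns [sin(u.m)] into [2 cos(u.m) sin u_l], and
the polarized composition law
[conj(e_k) (e_l c) + conj(e_l) (e_k c) = 2 delta_kl c] makes [sum_l sin^2 u_l]
cancel the denominator, leaving the integral of [cos(u.m)], i.e. [(2 pi)^8]
times the indicator of [m = 0].

The integrals are iterated one-dimensional ones, so linearity needs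
integrability at every level; it holds because
[|sin(u.m)| <= sum_l |m_l| |sin u_l|] makes the integrand bounded in spite of the
singularity of the symbol.
*)

Require Import Defs.
From HB Require Import structures.
From mathcomp Require Import all_boot all_order all_algebra.
From mathcomp Require Import all_classical all_reals all_analysis.
From mathcomp Require Import measurable_realfun zify ring lra.
Import Order.TTheory GRing.Theory Num.Theory.
Import numFieldNormedType.Exports.
Local Open Scope classical_set_scope.
Local Open Scope ring_scope.

(** * Iterated integrals of bounded measurable functions *)

Section IteratedIntegral.
Context {R : realType}.
Implicit Types (g : seq R -> R) (n : nat).

Local Notation mu := (@lebesgue_measure R).
Local Notation circle := (`[(- pi)%R, pi%R]%classic : set R).

Definition circle_int (f : R -> R) : R := Rintegral mu circle f.

(* Joint measurability on [n]-tuples, phrased through arbitrary measurable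
   coordinate functions since [seq R] carries no measurable structure. *)
Definition seq_measurable n g :=
  forall d (X : measurableType d) (a : nat -> X -> R),
    (forall i, measurable_fun setT (a i)) ->
    measurable_fun setT (fun x => g (mkseq (a ^~ x) n)).

Definition seq_bounded n g :=
  exists M : R, forall u, size u = n -> `|g u| <= M.

Definition seq_integrable n g := seq_measurable n g /\ seq_bounded n g.

(** Writes [rcons u t] as a tuple of coordinate functions, constant in the first [n] places, so that
    [seq_measurable] applies to sections in the last variable. *)
Lemma mkseq_prefix_rcons {T : Type} (x0 : T) (u : seq T) (t : T) (n : nat) :
  size u = n ->
  mkseq (fun i => if (i < n)%N then nth x0 u i else t) n.+1 = rcons u t.
Proof.
move=> su; apply: (@eq_from_nth _ x0); first by rewrite size_mkseq size_rcons su.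
move=> i; rewrite size_mkseq => hi; rewrite nth_mkseq// nth_rcons su.
by case: ltnP => // h; rewrite ifT // eqn_leq h -ltnS hi.
Qed.

Lemma seq_measurable_rcons n g u : size u = n -> seq_measurable n.+1 g ->
  measurable_fun setT (fun t => g (rcons u t)).
Proof.
move=> su mg.
have := mg _ R (fun i t => if (i < n)%N then nth 0 u i else t).
rewrite (_ : (fun t => _) = (fun t => g (rcons u t))); last first.
  by apply/funext => t; rewrite mkseq_prefix_rcons.
by apply=> i; case: (ltnP i n) => _.
Qed.

Lemma circle_measure : mu circle = (2 * pi)%:E.
Proof.
rewrite lebesgue_measure_itv/= lte_fin gtrN ?pi_gt0//.
by rewrite opprK -mulr2n mulr_natl.
Qed.

Lemma circle_measure_lty : (mu circle < +oo)%E.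
Proof. by rewrite circle_measure ltry. Qed.

Lemma seq_integrable_rcons n g u : size u = n -> seq_integrable n.+1 g ->
  mu.-integrable circle (EFin \o (fun t => g (rcons u t))).
Proof.
move=> su [mg [M hM]]; apply: measurable_bounded_integrable => //.
- exact: circle_measure_lty.
- apply: measurable_funTS; exact: (@seq_measurable_rcons n).
- exists M; split; first exact: num_real.
  move=> x Mx y _; apply: le_trans (ltW Mx); apply: hM.
  by rewrite size_rcons su.
Qed.

(** Tonelli's theorem applied separately to the positive and negative parts of [F], each extended by
    zero outside the circle. *)
Lemma measurable_circle_int {d} {X : measurableType d} (F : X * R -> R) :
  measurable_fun setT F ->
  measurable_fun setT (fun x => circle_int (fun t => F (x, t))).
Proof.
move=> mF.
pose G x : \bar R := (\int[mu]_(t in circle) ((EFin \o F)^\+ (x, t))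
  - \int[mu]_(t in circle) ((EFin \o F)^\- (x, t)))%E.
have -> : (fun x => circle_int (fun t => F (x, t))) = fine \o G.
  apply/funext => x; rewrite /circle_int /Rintegral integralE /G /=.
  by congr (fine (_ - _)); apply: eq_integral => t _; rewrite ?funeposE ?funenegE.
suff mG : measurable_fun setT G by exact: measurableT_comp.
have mE : measurable_fun setT (EFin \o F) by exact/measurable_EFinP.
have mI : measurable ([set: X] `*` circle).
  by apply: measurableX => //; exact: measurable_itv.
have aux (f : X * R -> \bar R) : measurable_fun setT f ->
    (forall z, 0 <= f z)%E ->
  measurable_fun setT (fun x => \int[mu]_(t in circle) f (x, t))%E.
  move=> mf f0.
  have : measurable_fun setT
      (fubini_F mu (f \_ ([set: X] `*` circle))).
    apply: measurable_fun_fubini_tonelli_F.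
      by apply/(measurable_restrictT _ mI); apply: measurable_funTS.
    by move=> z; rewrite patchE; case: ifP.
  congr (measurable_fun _ _); apply/funext => x.
  rewrite /fubini_F [RHS]integral_mkcond; apply: eq_integral => t _.
  rewrite !patchE; congr (if _ then _ else _).
  by apply/idP/idP; rewrite !inE/=; [case|split].
apply: emeasurable_funB.
- apply: (aux (EFin \o F)^\+%E) => //; exact: measurable_funepos.
- apply: (aux (EFin \o F)^\-%E) => //; exact: measurable_funeneg.
Qed.

Lemma seq_integrable_circle_int n g : seq_integrable n.+1 g ->
  seq_integrable n (fun u => circle_int (fun t => g (rcons u t))).
Proof.
move=> ig; have [mg [M hM]] := ig; split.
  move=> d X a ma.
  have := @measurable_circle_int _ _
    (fun z : X * R => g (rcons (mkseq (a ^~ z.1) n) z.2)).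
  apply.
  have := mg _ _ (fun i (z : X * R) => if (i < n)%N then a i z.1 else z.2).
  have E (z : X * R) : mkseq (fun i => if (i < n)%N then a i z.1 else z.2) n.+1 =
      rcons (mkseq (a ^~ z.1) n) z.2.
    rewrite -(mkseq_prefix_rcons 0 _ _ n) ?size_mkseq//.
    by apply: eq_mkseq => i; case: ltnP => // h; rewrite nth_mkseq.
  rewrite (_ : (fun z => _) = (fun z : X * R => g (rcons (mkseq (a ^~ z.1) n) z.2)));
    last by apply/funext => z; rewrite E.
  apply=> i; case: (ltnP i n) => _.
    by apply: measurableT_comp => //; exact: measurable_fst.
  exact: measurable_snd.
exists (M * (2 * pi)) => u su.
have iu := seq_integrable_rcons n g u su ig.
apply: le_trans (le_normr_Rintegral _ iu) _ => //.
rewrite -[2 * pi]/(fine (2 * pi)%:E) -circle_measure -Rintegral_cst//.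
apply: le_Rintegral => //.
- exact: integrable_norm.
- apply: measurable_bounded_integrable => //.
    exact: circle_measure_lty.
  exists M; split; first exact: num_real.
  move=> x Mx y _; rewrite (le_trans _ (ltW Mx)) ?ler_norm// ger0_norm//.
  by apply: le_trans (hM (rcons u 0) _); rewrite ?size_rcons ?su.
- by move=> t _; apply: hM; rewrite size_rcons su.
Qed.

Lemma seq_integrable_iterint k n g : seq_integrable (k + n) g ->
  seq_integrable n (iterint k g).
Proof.
elim: k n => [//|k IH] n ig /=.
by apply: seq_integrable_circle_int; apply: IH; rewrite addnS.
Qed.

Lemma iterintB k n g1 g2 u : size u = n ->
  seq_integrable (k + n) g1 -> seq_integrable (k + n) g2 ->
  iterint k (fun u => g1 u - g2 u) u = iterint k g1 u - iterint k g2 u.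
Proof.
elim: k n u => [//|k IH] n u su i1 i2 /=.
rewrite -RintegralB//; last 2 first.
- by apply: (seq_integrable_rcons n _ _ su); apply: seq_integrable_iterint; rewrite addnS.
- by apply: (seq_integrable_rcons n _ _ su); apply: seq_integrable_iterint; rewrite addnS.
apply: eq_Rintegral => t _; apply: (IH n.+1); rewrite ?size_rcons ?su ?addnS//.
Qed.

Lemma iterintD k n g1 g2 u : size u = n ->
  seq_integrable (k + n) g1 -> seq_integrable (k + n) g2 ->
  iterint k (fun u => g1 u + g2 u) u = iterint k g1 u + iterint k g2 u.
Proof.
elim: k n u => [//|k IH] n u su i1 i2 /=.
rewrite -RintegralD//; last 2 first.
- by apply: (seq_integrable_rcons n _ _ su); apply: seq_integrable_iterint; rewrite addnS.
- by apply: (seq_integrable_rcons n _ _ su); apply: seq_integrable_iterint; rewrite addnS.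
apply: eq_Rintegral => t _; apply: (IH n.+1); rewrite ?size_rcons ?su ?addnS//.
Qed.

Lemma seq_integrable0 n : seq_integrable n (fun _ => 0).
Proof.
split; first by move=> d X a _; exact: measurable_cst.
by exists 0 => u _; rewrite normr0.
Qed.

Lemma seq_integrableD n g1 g2 : seq_integrable n g1 -> seq_integrable n g2 ->
  seq_integrable n (fun u => g1 u + g2 u).
Proof.
move=> [m1 [M1 b1]] [m2 [M2 b2]]; split.
  by move=> d X a ma; apply: measurable_funD; [exact: m1|exact: m2].
exists (M1 + M2) => u su; apply: le_trans (ler_normD _ _) _.
by apply: lerD; [exact: b1|exact: b2].
Qed.

Lemma iterint0 k u : iterint k (fun _ => 0) u = 0 :> R.
Proof.
elim: k u => [//|k IH] u /=.
under eq_Rintegral do rewrite IH.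
by rewrite Rintegral_cst// mul0r.
Qed.

(** The two claims are proved together because the inductive use of [iterintD] requires the
    remaining sum to be integrable. *)
Lemma iterint_sum (I : Type) (r : seq I) k n (g : I -> seq R -> R) u :
  size u = n -> (forall i, seq_integrable (k + n) (g i)) ->
  iterint k (fun u => \sum_(i <- r) g i u) u = \sum_(i <- r) iterint k (g i) u
  /\ seq_integrable (k + n) (fun u => \sum_(i <- r) g i u).
Proof.
move=> su ig; elim: r => [|i r [IHe IHi]].
  under eq_fun do rewrite big_nil.
  by rewrite big_nil iterint0; split => //; exact: seq_integrable0.
under eq_fun do rewrite big_cons.
by rewrite big_cons (iterintD _ _ _ _ _ su)// IHe; split => //; exact: seq_integrableD.
Qed.

Lemma eq_iterint k g1 g2 u :
  (forall v, size v = (k + size u)%N -> g1 v = g2 v) ->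
  iterint k g1 u = iterint k g2 u.
Proof.
elim: k u => [|k IH] u h /=; first exact: h.
apply: eq_Rintegral => t _; apply: IH => v sv; apply: h.
by rewrite sv size_rcons addnS.
Qed.

(* Lets one modify the integrand on a null set of the last variable, without
   null sets in the product space. *)
Lemma eq_iterint_innermost k n g1 g2 u : size u = n ->
  (forall v, size v = (k + n)%N ->
     circle_int (fun t => g1 (rcons v t)) = circle_int (fun t => g2 (rcons v t))) ->
  iterint k.+1 g1 u = iterint k.+1 g2 u.
Proof.
elim: k n u => [|k IH] n u su h; first exact: h.
rewrite /=; apply: eq_Rintegral => t _; apply: (IH n.+1); first by rewrite size_rcons su.
by move=> v sv; apply: h; rewrite sv addnS.
Qed.

End IteratedIntegral.

(** * Trigonometric estimates and integrals *)

Section Trigonometry.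
Context {R : realType}.
Local Notation circle := (`[(- pi)%R, pi%R]%classic : set R).

Lemma norm_sinD_le (a b : R) : `|sin (a + b)| <= `|sin a| + `|sin b|.
Proof.
rewrite sinD (le_trans (ler_normD _ _))// !normrM lerD//.
  by rewrite ler_piMr// cos_max.
by rewrite ler_piMl// cos_max.
Qed.

Lemma norm_sin_sum_le (I : Type) (r : seq I) (a : I -> R) :
  `|sin (\sum_(i <- r) a i)| <= \sum_(i <- r) `|sin (a i)|.
Proof.
elim: r => [|i r IH]; first by rewrite !big_nil sin0 normr0.
by rewrite !big_cons (le_trans (norm_sinD_le _ _))// lerD2l.
Qed.

Lemma norm_sin_mulz_le (t : R) (m : int) :
  `|sin (t * m%:~R)| <= `|m%:~R| * `|sin t|.
Proof.
(* Both sides are even in [m], so induction on a natural number suffices. *)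
wlog : m / exists n : nat, m = n.
  move=> H; case: (intP m) => [|n|n].
  - by apply: H; exists 0%N.
  - by apply: H; exists n.+1.
  - rewrite mulrNz mulrN sinN !normrN.
    by apply: H; exists n.+1.
case=> n ->{m}; elim: n => [|n IH]; first by rewrite mulr0 sin0 !normr0 mul0r.
rewrite intS intrD mulrDr mulr1 (le_trans (norm_sinD_le _ _))//.
have -> : `|1%:~R + n%:~R : R| = 1 + `|n%:~R : R| by rewrite !ger0_norm ?addr_ge0 ?ler0z.
by rewrite mulrDl mul1r lerD2l.
Qed.

Lemma sin_eq0_circle (t : R) : circle t -> sin t = 0 ->
  t \in [:: - pi; 0; pi].
Proof.
rewrite /= in_itv/= => /andP[lt tu] st; rewrite !inE.
case: (eqVneq t (- pi)) => //= t1; case: (eqVneq t 0) => //= t2.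
case: (eqVneq t pi) => //= t3.
have [t0|t0] := ltP 0 t.
  have : 0 < sin t by rewrite sin_gt0_pi// t0 lt_neqAle t3.
  by rewrite st ltxx.
have : 0 < sin (- t).
  by rewrite sin_gt0_pi// oppr_gt0 lt_neqAle t2 t0/= ltrNl lt_neqAle eq_sym t1.
by rewrite sinN st oppr0 ltxx.
Qed.

(** Orthogonality of characters; [a] is the phase contributed by the other variables. For [m != 0]
    the primitive [F] takes equal values at both endpoints, since [sin (pi * m%:~R)] vanishes. *)
Lemma circle_int_cos (c a : R) (m : int) :
  circle_int (fun t => c * cos (a + t * m%:~R)) =
  (if m == 0 then 2 * pi else 0) * (c * cos a).
Proof.
have [->|m0] := eqVneq m 0.
  rewrite /circle_int.
  under eq_Rintegral do rewrite mulr0 addr0.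
  rewrite Rintegral_cst// mulrC; congr (_ * _).
  by rewrite -[RHS]/(fine (2 * pi)%:E) -circle_measure.
have mR : m%:~R != 0 :> R by rewrite intr_eq0.
pose F t := c * sin (a + t * m%:~R) / m%:~R.
have dF t : is_derive (t : R) (1 : R) F (c * cos (a + t * m%:~R)).
  have d1 : is_derive t (1:R) (fun t => a + t * m%:~R) (m%:~R).
    by apply: is_derive_eq; rewrite !add0r mul1r scaler0 add0r /GRing.scale/= mulr1.
  have d2 : is_derive t (1:R) (fun t => sin (a + t * m%:~R)) (cos (a + t * m%:~R) * m%:~R).
    exact: is_derive1_comp.
  rewrite /F; apply: is_derive_eq; rewrite /GRing.scale/= !(mulr0, mul0r, addr0, add0r).
  by field.
rewrite /circle_int /Rintegral (@continuous_FTC2 _ _ F).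
- have s0 : sin (pi * m%:~R) = 0 :> R.
    apply/eqP; rewrite -normr_le0 (le_trans (norm_sin_mulz_le _ _))//.
    by rewrite sinpi normr0 mulr0.
  by rewrite -EFinB /= /F !sinD mulNr cosN sinN s0 !(oppr0, mulr0, addr0) subrr mul0r.
- by rewrite gtrN// pi_gt0.
- apply: continuous_subspaceT => t.
  apply: cvgM; first exact: cvg_cst.
  apply: continuous_comp; last exact: continuous_cos.
  apply: cvgD; first exact: cvg_cst.
  apply: cvgM; [exact: cvg_id|exact: cvg_cst].
- have cF t : {for t, continuous F}.
    by apply/differentiable_continuous/derivable1_diffP; case: (dF t).
  split.
  + by move=> t _; case: (dF t).
  + by apply: cvg_at_right_filter; exact: cF.
  + by apply: cvg_at_left_filter; exact: cF.
- by move=> t _; rewrite derive1E; case: (dF t).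
Qed.

End Trigonometry.

(** * The Fourier symbol of the fundamental solution *)

Section Symbol.
Context {R : realType}.
Local Notation circle := (`[(- pi)%R, pi%R]%classic : set R).
Implicit Types (u : seq R) (x : pt) (k l : 'I_8).

Definition sin2sum u : R := \sum_(m < 8) sin (nth 0 u m) ^+ 2.

Definition symbol k x u : R := sin (nth 0 u k) * sin (dotu u x) / sin2sum u.

Definition cos_symbol k l x u : R :=
  2 * (sin (nth 0 u k) * sin (nth 0 u l)) / sin2sum u * cos (dotu u x).

Lemma sin2sum_ge0 u : 0 <= sin2sum u.
Proof. by apply: sumr_ge0 => i _; exact: sqr_ge0. Qed.

Lemma sqr_sin_le_sin2sum u k : sin (nth 0 u k) ^+ 2 <= sin2sum u.
Proof.
rewrite /sin2sum (bigD1 k)//= lerDl.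
by apply: sumr_ge0 => i _; exact: sqr_ge0.
Qed.

(** From [2|a||b| <= a^2 + b^2], where each square is at most [sin2sum u]; this also covers
    [k = l]. *)
Lemma norm_sin_mul_le_sin2sum u k l :
  `|sin (nth 0 u k) * sin (nth 0 u l)| <= sin2sum u.
Proof.
have := sqr_sin_le_sin2sum u k; have := sqr_sin_le_sin2sum u l.
set a := sin _; set b := sin _; set s := sin2sum u => ha hb.
have := sqr_ge0 (`|b| - `|a|); rewrite normrM sqrrB !real_normK ?num_real//.
lra.
Qed.

Lemma dotuD u x y : dotu u (x + y) = dotu u x + dotu u y.
Proof.
rewrite /dotu -big_split/=; apply: eq_bigr => i _.
by rewrite mxE intrD mulrDr.
Qed.

Lemma dotuN u x : dotu u (- x) = - dotu u x.
Proof.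
by rewrite /dotu -sumrN; apply: eq_bigr => i _; rewrite mxE mulrNz mulrN.
Qed.

Lemma dotu_ue u l : dotu u (ue l) = nth 0 u l.
Proof.
rewrite /dotu (bigD1 l)//= mxE !eqxx mulr1 big1 ?addr0// => i il.
by rewrite mxE eqxx (negbTE il) mulr0.
Qed.

(* The 1/|u| singularity at the zeros of [sin2sum] is compensated by the zero of
   [sin (dotu u x)]: the integrand of the fundamental solution is bounded. *)
Lemma norm_symbol_le k x u :
  `|symbol k x u| <= \sum_(m < 8) `|(x 0 m)%:~R|.
Proof.
(* Where the denominator vanishes, its inverse is 0 by convention, and so is the symbol. *)
have [s0|s0] := eqVneq (sin2sum u) 0.
  by rewrite /symbol s0 invr0 mulr0 normr0 sumr_ge0.
have sp : 0 < sin2sum u by rewrite lt_neqAle eq_sym s0 sin2sum_ge0.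
rewrite /symbol normrM normfV (gtr0_norm sp) ler_pdivrMr// mulr_suml normrM.
apply: (@le_trans _ _ (`|sin (nth 0 u k)| *
    \sum_(m < 8) (`|(x 0 m)%:~R| * `|sin (nth 0 u m)|))).
  apply: ler_wpM2l => //; apply: le_trans (norm_sin_sum_le _ _ _) _.
  by apply: ler_sum => m _; exact: norm_sin_mulz_le.
rewrite mulr_sumr; apply: ler_sum => m _.
by rewrite mulrCA ler_wpM2l// -normrM norm_sin_mul_le_sin2sum.
Qed.

(** This is [sin (a + b) - sin (a - b) = 2 cos a sin b] times the common inverse of [sin2sum u], so
    zeros of [sin2sum] need no separate case. *)
Lemma symbol_central_difference k l x u :
  symbol k (x + ue l) u - symbol k (x - ue l) u = cos_symbol k l x u.
Proof.
by rewrite /symbol /cos_symbol !dotuD dotuN dotu_ue !sinD cosN sinN; ring.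
Qed.

Lemma norm_cos_symbol_le k l x u : `|cos_symbol k l x u| <= 2.
Proof.
have [s0|s0] := eqVneq (sin2sum u) 0.
  by rewrite /cos_symbol s0 invr0 mulr0 mul0r normr0.
have sp : 0 < sin2sum u by rewrite lt_neqAle eq_sym s0 sin2sum_ge0.
rewrite /cos_symbol normrM -[leRHS]mulr1 ler_pM ?cos_max//.
rewrite normrM normfV (gtr0_norm sp) ler_pdivrMr// normrM ger0_norm//.
by rewrite ler_wpM2l// norm_sin_mul_le_sin2sum.
Qed.

Section Measurability.
Context {d} {X : measurableType d} (a : nat -> X -> R) (n : nat)
  (ma : forall i, measurable_fun setT (a i)).

Lemma measurable_nth_mkseq i :
  measurable_fun setT (fun z => nth 0 (mkseq (a ^~ z) n) i : R).
Proof.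
have [h|h] := ltnP i n.
  by under eq_fun do rewrite nth_mkseq//; exact: ma.
under eq_fun do rewrite nth_default ?size_mkseq//.
exact: measurable_cst.
Qed.

Lemma measurable_sin_nth i :
  measurable_fun setT (fun z => sin (nth 0 (mkseq (a ^~ z) n) i) : R).
Proof.
apply: (measurableT_comp (f := sin)); last exact: measurable_nth_mkseq.
by apply: continuous_measurable_fun; exact: continuous_sin.
Qed.

Lemma measurable_dotu x : measurable_fun setT (fun z => dotu (mkseq (a ^~ z) n) x).
Proof.
apply: measurable_sum => i; apply: measurable_funM => //.
exact: measurable_nth_mkseq.
Qed.

Lemma measurable_cos_dotu x :
  measurable_fun setT (fun z => cos (dotu (mkseq (a ^~ z) n) x)).
Proof.
apply: (measurableT_comp (f := cos)); last exact: measurable_dotu.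
by apply: continuous_measurable_fun; exact: continuous_cos.
Qed.

Lemma measurable_inv_sin2sum :
  measurable_fun setT (fun z => (sin2sum (mkseq (a ^~ z) n))^-1).
Proof.
(* Inversion is discontinuous at 0, a value that [sin2sum] attains; on nonnegative reals it is the
   power with exponent -1, which is measurable. *)
under eq_fun do rewrite -powR_inv1 ?sin2sum_ge0//.
apply: (measurableT_comp (f := (powR (R:=R))^~ (- 1))).
  exact: measurable_powR.
by apply: measurable_sum => i; apply: measurable_funX; exact: measurable_sin_nth.
Qed.

End Measurability.

Lemma seq_integrable_symbol n k x : seq_integrable n (symbol k x).
Proof.
split; last by eexists => u _; exact: norm_symbol_le.
move=> d X a ma; apply: measurable_funM; last exact: measurable_inv_sin2sum.
apply: measurable_funM; first exact: measurable_sin_nth.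
apply: (measurableT_comp (f := sin)); last exact: measurable_dotu.
by apply: continuous_measurable_fun; exact: continuous_sin.
Qed.

Lemma seq_integrable_cos_symbol n k l x : seq_integrable n (cos_symbol k l x).
Proof.
split; last by eexists => u _; exact: norm_cos_symbol_le.
move=> d X a ma; apply: measurable_funM; last exact: measurable_cos_dotu.
apply: measurable_funM; last exact: measurable_inv_sin2sum.
apply: measurable_funM => //.
by apply: measurable_funM; exact: measurable_sin_nth.
Qed.

Lemma sum_cos_symbol_diag x u : sin2sum u != 0 ->
  \sum_(k < 8) cos_symbol k k x u = 2 * cos (dotu u x).
Proof.
move=> s0; rewrite /cos_symbol -!mulr_suml -mulr_sumr.
have -> : \sum_(k < 8) (sin (nth 0 u k) * sin (nth 0 u k)) = sin2sum u.
  by apply: eq_bigr => k _; rewrite expr2.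
by rewrite mulfK.
Qed.

(** Coordinates beyond the end of [u] read as 0, so [dotu u x] is the partial phase of the variables
    fixed so far. *)
Lemma dotu_rcons u t x k : size u = k -> dotu (rcons u t) x = dotu u x + t * (x 0 k)%:~R.
Proof.
move=> su; rewrite /dotu (bigD1 k)//= [in RHS](bigD1 k)//= nth_rcons su ltnn eqxx.
rewrite [nth 0 u k]nth_default ?su// mul0r add0r addrC; congr (_ + _).
apply: eq_bigr => i ik; rewrite nth_rcons su; case: ltnP => // ki.
by rewrite (_ : (i == k :> nat) = false) ?nth_default ?su//; exact: negbTE.
Qed.

(** Stated for an arbitrary prefix [u] to allow induction: each remaining variable contributes
    [2 * pi] if its frequency is 0 and annihilates the integral otherwise. *)
Lemma iterint_cos (n : nat) x u : (n + size u = 8)%N ->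
  iterint n (fun v => 2 * cos (dotu v x)) u =
  (\prod_(l < 8 | (size u <= l)%N) (if x 0 l == 0 then 2 * pi else 0)) *
    (2 * cos (dotu u x)).
Proof.
elim: n u => [|n IH] u su.
  rewrite /= big_pred0 ?mul1r// => l.
  by rewrite -[size u]add0n su; apply/negbTE; rewrite -ltnNge.
have su8 : (size u < 8)%N by rewrite -su addSn ltnS leq_addl.
pose i := Ordinal su8.
rewrite /= -/(circle_int _).
rewrite (_ : circle_int _ = circle_int (fun t =>
   (\prod_(l < 8 | (size u < l)%N) (if x 0 l == 0 then 2 * pi else 0)) * 2 *
     cos (dotu u x + t * (x 0 i)%:~R))); last first.
  congr circle_int; apply/funext => t; rewrite IH ?size_rcons ?addnS ?su//.
  by rewrite (@dotu_rcons _ _ _ i)// mulrA.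
rewrite circle_int_cos [in RHS](bigD1 i)//= !mulrA; congr (_ * _ * _ * _).
by apply: eq_bigl => l; rewrite ltn_neqAle eq_sym andbC.
Qed.

(** The denominator cancels wherever [sin2sum] is nonzero. With the first seven variables fixed, it
    can vanish only when the last one is a zero of the sine, hence on a finite set. *)
Lemma iterint_sum_cos_symbol_diag x :
  iterint 8 (fun v => \sum_(k < 8) cos_symbol k k x v) [::] =
  if x == 0 then 2 * (2 * pi) ^+ 8 else 0.
Proof.
have ic n : seq_integrable n (fun v => \sum_(k < 8) cos_symbol k k x v).
  (* Only the integrability half is wanted; [nseq n 0] is a dummy prefix of length [n]. *)
  have := @iterint_sum R _ (index_enum 'I_8) 0 n (fun k => cos_symbol k k x)
    (nseq n 0).
  by rewrite size_nseq add0n => -[]// i; exact: seq_integrable_cos_symbol.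
rewrite (@eq_iterint_innermost R 7 0 _ (fun v => 2 * cos (dotu v x)))//; last first.
  move=> v sv; rewrite /circle_int /Rintegral; congr fine.
  apply: ae_eq_integral => //.
  - apply/measurable_EFinP; apply: measurable_funTS.
    exact: (@seq_measurable_rcons R 7 _ v sv (ic 8).1).
  - apply/measurable_EFinP; apply: measurable_funTS.
    apply: (@seq_measurable_rcons R 7 (fun v => 2 * cos (dotu v x))) => //.
    move=> d X a ma; apply: measurable_funM => //; exact: measurable_cos_dotu.
  - exists [set` [:: - pi; 0; pi]]; split.
    + by apply: countable_measurable => //; apply: finite_set_countable; exact: finite_seq.
    + by apply: countable_lebesgue_measure0; apply: finite_set_countable; exact: finite_seq.
    + move=> t /= /not_implyP[tc tn]; apply: sin_eq0_circle => //.
      apply: contra_notP tn => /eqP st; congr (_%:E); apply: sum_cos_symbol_diag.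
      apply: contra st => /eqP s0; rewrite -sqrf_eq0 -normr_le0.
      have := sqr_sin_le_sin2sum (rcons v t) ord_max.
      rewrite s0 nth_rcons sv /= => h; rewrite ger0_norm ?sqr_ge0//.
have d0 : dotu [::] x = 0 :> R by apply: big1 => i _; rewrite nth_nil mul0r.
rewrite iterint_cos//= d0 cos0 mulr1.
have [->|x0] := eqVneq x 0.
  rewrite mulrC; congr (_ * _).
  under eq_bigr do rewrite mxE eqxx.
  by rewrite prodr_const card_ord.
have [l xl] : exists l, x 0 l != 0.
  apply/existsP; apply: contraNT x0; rewrite negb_exists => /forallP h.
  by apply/eqP/rowP => l; rewrite mxE; have := h l; rewrite negbK => /eqP.
by rewrite (bigD1 l)//= (negbTE xl) !mul0r.
Qed.

(** Equals [(2 * pi) ^+ 8] times the coefficient of [oebar R k] in the central difference of [E1] in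
    direction [l]. *)
Definition symbol_diff k l x : R :=
  iterint 8 (symbol k (x + ue l)) [::] - iterint 8 (symbol k (x - ue l)) [::].

Lemma symbol_diffE k l x :
  symbol_diff k l x = iterint 8 (cos_symbol k l x) [::].
Proof.
have E := @iterintB R 8 0 (symbol k (x + ue l)) (symbol k (x - ue l)) [::] erefl
  (seq_integrable_symbol _ _ _) (seq_integrable_symbol _ _ _).
apply: etrans (esym E) _.
by apply: eq_iterint => u _; exact: symbol_central_difference.
Qed.

(** The symmetry becomes visible only after differencing, when [sin u_l] appears beside [sin u_k].
    It is what the polarization argument requires. *)
Lemma symbol_diffC k l x : symbol_diff k l x = symbol_diff l k x.
Proof.
rewrite !symbol_diffE; apply: eq_iterint => u _.
by rewrite /cos_symbol (mulrC (sin (nth 0 u k))).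
Qed.

Lemma sum_symbol_diff_diag x :
  \sum_(k < 8) symbol_diff k k x = if x == 0 then 2 * (2 * pi) ^+ 8 else 0.
Proof.
rewrite -iterint_sum_cos_symbol_diag.
have := @iterint_sum R _ (index_enum 'I_8) 8 0 (fun k => cos_symbol k k x) [::] erefl.
case=> [k|-> _]; first exact: seq_integrable_cos_symbol.
by apply: eq_bigr => k _; exact: symbol_diffE.
Qed.

End Symbol.

(** * Polarized composition law of the octonions *)

Section Octonions.
Context {R : realType}.
Implicit Types (a b c : oct R) (r : R) (k l : 'I_8).

Lemma omulDl a a' b : omul (a + a') b = omul a b + omul a' b.
Proof.
apply/rowP => k; rewrite !mxE -big_split; apply: eq_bigr => i _ /=.
by rewrite -big_split; apply: eq_bigr => j _ /=; rewrite mxE !mulrDl.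
Qed.

Lemma omulDr a b b' : omul a (b + b') = omul a b + omul a b'.
Proof.
apply/rowP => k; rewrite !mxE -big_split; apply: eq_bigr => i _ /=.
by rewrite -big_split; apply: eq_bigr => j _ /=; rewrite mxE mulrDr mulrDl.
Qed.

Lemma omulZl r a b : omul (r *: a) b = r *: omul a b.
Proof.
apply/rowP => k; rewrite !mxE mulr_sumr; apply: eq_bigr => i _ /=.
by rewrite mulr_sumr; apply: eq_bigr => j _ /=; rewrite mxE !mulrA.
Qed.

Lemma omulZr r a b : omul a (r *: b) = r *: omul a b.
Proof.
apply/rowP => k; rewrite !mxE mulr_sumr; apply: eq_bigr => i _ /=.
by rewrite mulr_sumr; apply: eq_bigr => j _ /=; rewrite mxE; ring.
Qed.

Lemma omulBl a a' b : omul (a - a') b = omul a b - omul a' b.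
Proof. by rewrite omulDl -scaleN1r omulZl scaleN1r. Qed.

Lemma omulBr a b b' : omul a (b - b') = omul a b - omul a b'.
Proof. by rewrite omulDr -scaleN1r omulZr scaleN1r. Qed.

Lemma omul_suml (I : Type) (s : seq I) (a : I -> oct R) b :
  omul (\sum_(i <- s) a i) b = \sum_(i <- s) omul (a i) b.
Proof.
elim: s => [|i s IH]; last by rewrite !big_cons omulDl IH.
by rewrite !big_nil -[X in omul X](scale0r (0 : oct R)) omulZl scale0r.
Qed.

(** Integer structure constants on plain naturals, so that octonion identities can be decided by
    computation. *)
Definition ocz (i j k : nat) : int :=
  if i == 0%N then (j == k)%:R
  else if j == 0%N then (i == k)%:R
  else if k == 0%N then - (i == j)%:R
  else if (i, j, k) \in flatten (map cyc fano_triples) then 1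
  else if (j, i, k) \in flatten (map cyc fano_triples) then -1
  else 0.

Lemma oczE (i j k : 'I_8) : oc R i j k = (ocz i j k)%:~R.
Proof.
rewrite /oc /ocz /eps -!val_eqE /=.
by do ![case: ifP => _]; rewrite ?rmorphN ?rmorph1 ?rmorph0 ?rmorph_nat.
Qed.

Definition conj_sgn (k : nat) : int := if k == 0%N then 1 else -1.

(* Matrix entries of [a |-> conj(e_k) (e_l a) + conj(e_l) (e_k a)]. *)
Definition polar_entry (k l j q : nat) : int :=
  foldr (fun p s => (conj_sgn k * (ocz l j p * ocz k p q)
                   + conj_sgn l * (ocz k j p * ocz l p q)) + s) 0 (iota 0 8).

Lemma polar_entryE (k l j q : 'I_8) :
  polar_entry k l j q = 2 * ((k == l) && (j == q))%:R.
Proof.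
have : all (fun k : nat => all (fun l : nat => all (fun j => all (fun q =>
    polar_entry k l j q == 2 * ((k == l) && (j == q))%:R)
  (iota 0 8)) (iota 0 8)) (iota 0 8)) (iota 0 8) by vm_compute.
have h (i : 'I_8) : (i : nat) \in iota 0 8 by rewrite mem_iota ltn_ord.
move=> /allP/(_ _ (h k))/allP/(_ _ (h l))/allP/(_ _ (h j))/allP/(_ _ (h q))/eqP.
by rewrite !val_eqE.
Qed.

Lemma omul_oe l c : omul (oe R l) c = \row_q \sum_(j < 8) c 0 j * (ocz l j q)%:~R.
Proof.
apply/rowP => q; rewrite !mxE (bigD1 l)//= [X in _ + X]big1 ?addr0.
  by apply: eq_bigr => j _; rewrite mxE !eqxx mul1r oczE.
move=> i il; apply: big1 => j _.
by rewrite mxE eqxx (negbTE il) !mul0r.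
Qed.

Lemma oebarE k : oebar R k = (conj_sgn k)%:~R *: oe R k.
Proof.
rewrite /oebar /conj_sgn; case: ifP => _; first by rewrite scale1r.
by rewrite rmorphN rmorph1 scaleN1r.
Qed.

(** Compared entry by entry, this is the table of [8^4] integers checked in [polar_entryE]. The
    bracketing matters, since octonions are not associative. *)
Lemma oct_polarization k l c :
  omul (oebar R k) (omul (oe R l) c) + omul (oebar R l) (omul (oe R k) c) =
  (2 * (k == l)%:R) *: c.
Proof.
rewrite !oebarE !omulZl !omul_oe; apply/rowP => q; rewrite !mxE.
under eq_bigr do rewrite mxE mulr_suml.
under [X in _ + _ * X]eq_bigr do rewrite mxE mulr_suml.
rewrite exchange_big [X in _ + _ * X]exchange_big/= !mulr_sumr -big_split/=.
transitivity (\sum_(j < 8) c 0 j * (polar_entry k l j q)%:~R).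
  apply: eq_bigr => j _; rewrite !mulr_sumr -big_split/=.
  have -> : polar_entry k l j q = \sum_(p < 8)
      (conj_sgn k * (ocz l j p * ocz k p q) + conj_sgn l * (ocz k j p * ocz l p q)).
    by rewrite -(big_mkord xpredT (fun p => conj_sgn k * (ocz l j p * ocz k p q)
       + conj_sgn l * (ocz k j p * ocz l p q))) unlock.
  rewrite rmorph_sum mulr_sumr; apply: eq_bigr => p _.
  by rewrite /= rmorphD !rmorphM/=; ring.
rewrite (bigD1 q)//= big1 ?addr0.
  by rewrite polar_entryE eqxx andbT rmorphM/= !rmorph_nat mulrC.
by move=> j jq; rewrite polar_entryE (negbTE jq) andbF mulr0.
Qed.

Lemma sum_symmetric_polarization (T : 'I_8 -> 'I_8 -> R) c :
  (forall k l, T k l = T l k) ->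
  \sum_l \sum_k T k l *: omul (oebar R k) (omul (oe R l) c) =
  (\sum_k T k k) *: c.
Proof.
move=> TC; set S := LHS.
(* Adding the sum to itself with indices exchanged pairs each product with its polar partner, so
   only the diagonal survives. *)
have S2 : S + S = (2 * \sum_k T k k) *: c.
  rewrite {2}/S exchange_big /S -big_split mulr_sumr scaler_suml/=.
  apply: eq_bigr => l _; rewrite -big_split/= (bigD1 l)//= big1.
    by rewrite addr0 -scalerDr oct_polarization eqxx mulr1 scalerA mulrC.
  move=> k kl; rewrite (TC l k) -scalerDr oct_polarization (negbTE kl).
  by rewrite mulr0 scale0r scaler0.
apply: (@scalerI _ _ (2 : R)); first by rewrite pnatr_eq0.
by rewrite scalerA -S2 -mulr2n scaler_nat.
Qed.

Lemma E1_symbol (m : pt) :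
  E1 R m = \sum_(k < 8) ((2 * pi) ^- 8 * iterint 8 (symbol k m) [::]) *: oebar R k.
Proof. by []. Qed.

(** The fundamental solution property for constants. The differences are undivided: dividing by
    [2 * h] would give the lattice delta [h ^- 8]. *)
Lemma Eh_central_difference (h : R) (m : pt) c :
  \sum_l omul (Eh h (m + ue l) - Eh h (m - ue l)) (omul (oe R l) c) =
  if m == 0 then (2 * h ^- 7) *: c else 0.
Proof.
transitivity (\sum_l \sum_k (h ^- 7 * (2 * pi) ^- 8 * symbol_diff k l m) *:
    omul (oebar R k) (omul (oe R l) c)).
  apply: eq_bigr => l _.
  rewrite /Eh !E1_symbol -scalerBr omulZl -sumrB omul_suml scaler_sumr.
  apply: eq_bigr => k _; rewrite -scalerBl omulZl scalerA; congr (_ *: _).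
  by rewrite -mulrBr mulrA.
rewrite sum_symmetric_polarization; last by move=> k l; rewrite symbol_diffC.
rewrite -mulr_sumr sum_symbol_diff_diag; case: eqP => _; last by rewrite mulr0 scale0r.
congr (_ *: _); have p0 : (2 * pi : R) ^+ 8 != 0.
  by rewrite expf_neq0// mulf_neq0 ?pnatr_eq0// gt_eqF ?pi_gt0.
by rewrite (mulrC 2 (_ ^+ 8)) -mulrA mulKf// mulrC.
Qed.

End Octonions.

(** * Discrete Cauchy formula for constants *)

Section FiniteSupportSums.
Context {R : pzRingType} {I : choiceType} {V : lmodType R}.
Implicit Types F G : I -> V.

(** A sum [\sum_(x \in _)] with infinite support defaults to 0, so additivity needs finite supports.
    Any finite superset of the support is accepted, which makes closure under addition immediate. *)
Definition finsupp F := exists2 D : set I, finite_set D & forall x, ~ D x -> F x = 0.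

Lemma fsum_on (D : set I) F : (forall x, ~ D x -> F x = 0) ->
  \sum_(x \in [set: I]) F x = \sum_(x \in D) F x.
Proof. by move=> F0; apply/esym/fsbig_widen => // x [_ /F0]. Qed.

Lemma fsumTD F G : finsupp F -> finsupp G ->
  \sum_(x \in [set: I]) (F x + G x) =
  \sum_(x \in [set: I]) F x + \sum_(x \in [set: I]) G x.
Proof.
move=> [D fD F0] [E fE G0].
have FDE x : ~ (D `|` E) x -> F x = 0 by move=> /not_orP[/F0].
have GDE x : ~ (D `|` E) x -> G x = 0 by move=> /not_orP[_ /G0].
rewrite (fsum_on _ _ FDE) (fsum_on _ _ GDE) (fsum_on (D `|` E)).
  by rewrite fsbig_split// finite_setU.
by move=> x nx; rewrite FDE// GDE// addr0.
Qed.

Lemma finsuppD F G : finsupp F -> finsupp G -> finsupp (fun x => F x + G x).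
Proof.
move=> [D fD F0] [E fE G0]; exists (D `|` E); first by rewrite finite_setU.
by move=> x /not_orP[/F0 -> /G0 ->]; rewrite addr0.
Qed.

Lemma finsuppZ F (r : I -> R) : finsupp F -> finsupp (fun x => r x *: F x).
Proof. by move=> [D fD F0]; exists D => // x /F0 ->; rewrite scaler0. Qed.

Lemma fsumTZ F (r : R) : finsupp F ->
  \sum_(x \in [set: I]) r *: F x = r *: \sum_(x \in [set: I]) F x.
Proof.
move=> [D fD F0]; rewrite (fsum_on _ _ F0) (fsum_on D); last by move=> x /F0 ->; rewrite scaler0.
by rewrite !fsbig_finite// scaler_sumr.
Qed.

Lemma fsumT_sum (J : Type) (s : seq J) (F : J -> I -> V) :
  (forall j, finsupp (F j)) ->
  \sum_(x \in [set: I]) (\sum_(j <- s) F j x) =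
  \sum_(j <- s) \sum_(x \in [set: I]) F j x.
Proof.
move=> fF; suff [] : \sum_(x \in [set: I]) (\sum_(j <- s) F j x) =
    \sum_(j <- s) \sum_(x \in [set: I]) F j x /\
    finsupp (fun x => \sum_(j <- s) F j x) by [].
elim: s => [|j s [IH fs]].
  rewrite big_nil; under eq_fsbigr do rewrite big_nil.
  by rewrite fsbig1//; split => //; exists set0 => // x _; rewrite ?big_nil.
rewrite big_cons -IH; under eq_fsbigr do rewrite big_cons.
rewrite fsumTD//; split => //.
rewrite (_ : (fun x => _) = fun x => F j x + \sum_(i <- s) F i x); last first.
  by apply/funext => x; rewrite big_cons.
exact: finsuppD.
Qed.

End FiniteSupportSums.

Lemma fsumT_shift {I : zmodType} {V : zmodType} (F : I -> V) (v : I) :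
  \sum_(x \in [set: I]) F (x + v) = \sum_(x \in [set: I]) F x.
Proof.
rewrite [RHS](@reindex_fsbigT _ _ _ _ _ (fun x => x + v))//.
exists (fun x => x - v) => x; [exact: addrK|exact: subrK].
Qed.

(** * Lattice boundaries, summation by parts and the Cauchy formula *)

Section Lattice.
Context {R : realType}.
Implicit Types (B : set pt) (x y m : pt) (h : R) (l : 'I_8) (c : oct R).

Lemma bounded_finite B :
  (exists M : int, forall x, B x -> forall i, `|x 0 i| <= M) -> finite_set B.
Proof.
move=> [M HM]; have [M0|M0] := ltP M 0.
  rewrite (_ : B = set0)//; apply/seteqP; split=> // x /HM/(_ 0).
  by rewrite leNgt (lt_le_trans M0).
case: M M0 HM => // n _ HM.
(* The cube is an image of a finite function space: coordinates in [[-n, n]] are shifted by [n] into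
   [[0, 2n]]. *)
pose g (f : {ffun 'I_8 -> 'I_(2 * n).+1}) : pt := \row_i ((f i)%:Z - n%:Z).
apply: (@sub_finite_set _ _ (g @` setT)); last exact: finite_image.
move=> x /HM xn; exists [ffun i => inord (absz (x 0 i + n%:Z))] => //.
apply/rowP => i; rewrite mxE ffunE inordK; have := xn i; lia.
Qed.

Definition nbr_offsets : seq pt :=
  0 :: [seq ue l | l : 'I_8] ++ [seq - ue l | l : 'I_8].

Lemma bdry_finite B : finite_set B -> finite_set (bdry B).
Proof.
move=> fB.
apply: (@sub_finite_set _ _ ((fun p : pt * pt => p.1 - p.2) @` (B `*` [set` nbr_offsets]))).
  (* A boundary point has a neighbour [z] in [B], and [z - x] is one of finitely many offsets. *)
  move=> x [[z nz Bz] _]; exists (z, z - x); last by rewrite /= subKr.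
  split=> //=; rewrite /nbr_offsets inE mem_cat.
  case: nz => [->|[l [->|->]]]; first by rewrite subrr eqxx.
    by rewrite addrC addKr [X in _ || (X || _)]map_f ?mem_enum ?orbT.
  by rewrite addrC addKr [X in _ || (_ || X)](map_f (fun l => - ue l)) ?mem_enum ?orbT.
by apply: finite_image; apply: finite_setX => //; exact: finite_seq.
Qed.

Lemma chi_not_bdry B x z : ~ bdry B x -> nbhd x z -> chi R B z = chi R B x.
Proof.
move=> nb xz; rewrite /chi; have xx : nbhd x x by left.
by case: pselect => Bz; case: pselect => Bx //; exfalso; apply: nb; split;
  solve [by exists x | by exists z].
Qed.

Lemma dplus_not_bdry h B l x : ~ bdry B x -> dplus h B l x = 0.
Proof.
by move=> nb; rewrite /dplus (chi_not_bdry _ _ _ nb) ?subrr ?mul0r//; right; exists l; left.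
Qed.

Lemma dminus_not_bdry h B l x : ~ bdry B x -> dminus h B l x = 0.
Proof.
move=> nb; rewrite /dminus (chi_not_bdry _ _ (x - ue l) nb) ?subrr ?mul0r//.
by right; exists l; right.
Qed.

Lemma boundary_term_not_bdry h B l x (u v : oct R) : ~ bdry B x ->
  dminus h B l x *: u + dplus h B l x *: v = 0.
Proof.
by move=> nb; rewrite dplus_not_bdry// dminus_not_bdry// !scale0r addr0.
Qed.

Lemma sqr_le_Sig h B x l :
  dplus h B l x ^+ 2 <= Sig h B x /\ dminus h B l x ^+ 2 <= Sig h B x.
Proof.
rewrite /Sig (bigD1 l)//=; set S := \sum_(_ < _ | _) _.
have S0 : 0 <= S by apply: sumr_ge0 => i _; rewrite addr_ge0 ?sqr_ge0.
by have := sqr_ge0 (dplus h B l x); have := sqr_ge0 (dminus h B l x); split; lra.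
Qed.

(* On points with [Sig = 0] the normal is the junk value 0, consistently with
   the differences of [chi] vanishing there. *)
Lemma sqrt_cancel (s t : R) : t ^+ 2 <= s -> Num.sqrt s * (- 2 * t / Num.sqrt s) = - 2 * t.
Proof.
move=> ts; have [s0|s0] := eqVneq (Num.sqrt s) 0; last by rewrite mulrC divfK.
have : s <= 0 by rewrite -sqrtr_eq0 s0.
move=> /(le_trans ts) t0.
have /eqP -> : t == 0 by rewrite -sqrf_eq0 eq_le t0 sqr_ge0.
by rewrite mulr0 mul0r mulr0.
Qed.

Definition flux h c l m : oct R := omul (Eh h m) (omul (oe R l) c).

(** The square root in the surface element cancels those in the normals, and the factor [-1/2] of
    the star product cancels their [-2]. *)
Lemma sarea_kstar_cst h B x y c :
  sarea h B x *: kstar h B x y (fun=> c) =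
  (h ^+ 8 / 2) *: \sum_l (dminus h B l x *: flux h c l (ue l - x + y) +
                          dplus h B l x *: flux h c l (- ue l - x + y)).
Proof.
rewrite /sarea /kstar scalerA -scalerA -[in LHS]scalerA; congr (_ *: _).
rewrite scalerA !scaler_sumr; apply: eq_bigr => l _.
rewrite /flux; move: (Eh h (ue l - x + y)) (Eh h (- ue l - x + y)) => Em Ep.
rewrite (omulDl (_ *: Em) (_ *: Ep)) (omulZl _ Em) (omulZl _ Ep) scalerDr !scalerA.
have [hp hm] := sqr_le_Sig h B x l.
have ep := sqrt_cancel _ _ hp; have em := sqrt_cancel _ _ hm.
by congr (_ *: _ + _ *: _); rewrite /nplus /nminus mulrAC ?ep ?em mulrC; lra.
Qed.

Lemma finsupp_chi B (v : pt) (F : pt -> oct R) : finite_set B ->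
  finsupp (fun x => chi R B (x + v) *: F x).
Proof.
move=> fB; exists ((fun z => z - v) @` B); first exact: finite_image.
move=> x nx; rewrite /chi; case: pselect => Bx; last by rewrite scale0r.
by exfalso; apply: nx; exists (x + v) => //; rewrite addrK.
Qed.

(** Moves the differences from [chi] to [a]. The finite support is recorded as well because the sum
    over [l] is later exchanged with the lattice sum. *)
Lemma summation_by_parts h B l y (a : pt -> oct R) : finite_set B ->
  \sum_(x \in [set: pt]) (dminus h B l x *: a (ue l - x + y) +
                          dplus h B l x *: a (- ue l - x + y)) =
  h^-1 *: \sum_(x \in [set: pt])
            chi R B x *: (a (y - x + ue l) - a (y - x - ue l))
  /\ finsupp (fun x => dminus h B l x *: a (ue l - x + y) +
                       dplus h B l x *: a (- ue l - x + y)).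
Proof.
move=> fB.
pose P1 x := chi R B (x + 0) *: a (y - x + ue l).
pose P2 x := chi R B (x - ue l) *: a (y - x + ue l).
pose P3 x := chi R B (x + ue l) *: a (y - x - ue l).
pose P4 x := chi R B (x + 0) *: a (y - x - ue l).
have f1 : finsupp P1 by exact: finsupp_chi.
have f2 : finsupp P2 by exact: finsupp_chi.
have f3 : finsupp P3 by exact: finsupp_chi.
have f4 : finsupp P4 by exact: finsupp_chi.
have E x : dminus h B l x *: a (ue l - x + y) + dplus h B l x *: a (- ue l - x + y)
    = h^-1 *: ((P1 x + -1 *: P4 x) + (P3 x + -1 *: P2 x)).
  rewrite /P1 /P2 /P3 /P4 addr0 /dminus /dplus.
  rewrite (_ : ue l - x + y = y - x + ue l); last first.
    by rewrite addrC addrA addrAC.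
  rewrite (_ : - ue l - x + y = y - x - ue l); last by rewrite addrC addrA addrAC.
  apply/rowP => i; rewrite !mxE; ring.
have f5 : finsupp (fun x => (P1 x + -1 *: P4 x) + (P3 x + -1 *: P2 x)).
  by apply: finsuppD; apply: finsuppD => //; exact: finsuppZ.
split; last first.
  rewrite (_ : (fun x => _) = fun x => h^-1 *: ((P1 x + -1 *: P4 x) + (P3 x + -1 *: P2 x))).
    exact: finsuppZ.
  by apply/funext.
under eq_fsbigr do rewrite E.
rewrite fsumTZ//; congr (_ *: _).
(* Both sides are the sum over [z] of [chi R B z *: a (y - z)], with [z = x + ue l] in [P3] and
   [z = x - ue l] in [P2]; hence the shift by [ue l] twice. *)
have S23 : \sum_(x \in [set: pt]) P3 x = \sum_(x \in [set: pt]) P2 x.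
  rewrite -[RHS](fsumT_shift P2 (ue l + ue l)).
  apply: eq_fsbigr => x _; rewrite /P2 /P3 addrA addrK; congr (_ *: a _).
  by rewrite [x + ue l + ue l]addrAC -/(_ - _) !opprD !addrA subrK.
rewrite fsumTD; [|by apply: finsuppD => //; exact: finsuppZ..].
rewrite [X in _ + X]fsumTD//; last exact: finsuppZ.
rewrite (fsumTZ _ _ f2) S23 scaleN1r subrr addr0.
by apply: eq_fsbigr => x _; rewrite /P1 /P4 addr0 scaleN1r scalerBr.
Qed.

Lemma cauchy_cst h B y c : 0 < h -> finite_set B ->
  bint h B (fun x => kstar h B x y (fun=> c)) = chi R B y *: c.
Proof.
move=> h0 fB; rewrite /bint.
under eq_fsbigr do rewrite sarea_kstar_cst.
(* Off the boundary all differences of [chi] vanish, so the sum extends to the whole lattice, where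
   translations act. *)
rewrite -(fsum_on (R := R)); last first.
  move=> x nx; rewrite big1 ?scaler0// => l _; exact: boundary_term_not_bdry.
have sbp l := summation_by_parts h B l y (flux h c l) fB.
rewrite fsumTZ; last first.
  have fbd := bdry_finite _ fB; exists (bdry B) => // x nx; apply: big1 => l _.
  exact: boundary_term_not_bdry.
rewrite fsumT_sum; last by move=> l; case: (sbp l).
under eq_bigr do rewrite (sbp _).1.
rewrite -scaler_sumr -fsumT_sum; last first.
  move=> l; have := finsupp_chi B 0
    (fun x => flux h c l (y - x + ue l) - flux h c l (y - x - ue l)) fB.
  by move=> [D fD D0]; exists D => // x /D0; rewrite addr0.
have E x : \sum_l chi R B x *: (flux h c l (y - x + ue l) - flux h c l (y - x - ue l))
   = if x == y then chi R B y *: ((2 * h ^- 7) *: c) else 0.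
  rewrite -scaler_sumr /flux; under eq_bigr do rewrite -omulBl.
  rewrite Eh_central_difference subr_eq0 eq_sym.
  by case: eqP => [->//|_]; rewrite scaler0.
under eq_fsbigr do rewrite E.
rewrite (fsum_on (R := R) [set y]); last by move=> x /eqP; case: eqP.
rewrite fsbig_set1 eqxx !scalerA; congr (_ *: _).
(* The powers of [h] balance: [h^8/2] from the surface element, [h^-1] from the differences of
   [chi], and [2 h^-7] from the kernel multiply to 1. *)
by field; rewrite gt_eqF.
Qed.

Lemma kstarB h B x y (f g : pt -> oct R) :
  kstar h B x y (fun z => f z - g z) = kstar h B x y f - kstar h B x y g.
Proof.
rewrite /kstar -scalerBr -sumrB; congr (_ *: _); apply: eq_bigr => l _.
by rewrite !omulBr.
Qed.

Lemma bintB h B (f g : pt -> oct R) : finite_set B ->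
  bint h B (fun x => f x - g x) = bint h B f - bint h B g.
Proof.
move=> fB; rewrite /bint !fsbig_finite; try exact: bdry_finite.
by rewrite -sumrB; apply: eq_bigr => x _; rewrite scalerBr.
Qed.

(** By linearity the constant [f y] splits off, and its boundary integral is given by
    [cauchy_cst]. *)
Lemma Sop_Cop h B (f : pt -> oct R) y : 0 < h -> finite_set B ->
  Sop h B f y = 2 *: (Cop h B f y - chi R B y *: f y) + f y.
Proof.
move=> h0 fB; rewrite /Sop /Cop -(cauchy_cst h B y (f y) h0 fB) -bintB//.
by congr (_ *: bint h B _ + _); apply/funext => x; rewrite -kstarB.
Qed.

End Lattice.

Theorem mainTheorem10 (R : realType) (h : R) (B : set pt) (f : pt -> oct R) :
  0 < h ->
  (exists M : int, forall x : pt, B x -> forall i : 'I_8, `|x 0 i| <= M) ->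
  (forall y : pt, bdry_plus B y ->
     Cop h B f y = 2^-1 *: (f y + Sop h B f y)) /\
  (forall y : pt, bdry_minus B y ->
     Cop h B f y = 2^-1 *: (- f y + Sop h B f y)).
Proof.
(* Now [Sop] is [2 Cop + (1 - 2 chi) f y], and the two cases are [chi = 1] and [chi = 0]. *)
move=> h0 /bounded_finite fB; split=> y [_ By]; rewrite Sop_Cop//.
  have -> : chi R B y = 1 by rewrite /chi; case: (pselect (B y)).
  apply/rowP => i; move: (Cop h B f y) => C; rewrite !mxE; lra.
have -> : chi R B y = 0 by rewrite /chi; case: (pselect (B y)).
apply/rowP => i; move: (Cop h B f y) => C; rewrite !mxE; lra.
Qed.
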